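(* Let $k\ge 3$ and let $Q$ be a $k$-supernilpotent loop. Suppose that the nucleus $\mathrm{Nuc}(Q)$ is normal in $Q$. Then $Q/\mathrm{Nuc}(Q)$ is $(k-2)$-supernilpotent.
   Context: A loop is an algebra $(Q,\cdot,\backslash,/,1)$ in which $1$ is a two-sided identity for $\cdot$, $a\backslash b$ is the unique solution $x$ of $ax=b$, and $b/a$ is the unique solution $x$ of $xa=b$. The nucleus $\mathrm{Nuc}(Q)$ is the subloop of all $a\in Q$ such that $a(uv)=(au)v$, $u(av)=(ua)v$ and $u(va)=(uv)a$ for all $u,v\in Q$. A subloop is normal if it is the kernel of a loop homomorphism. A polynomial on an algebra $A$ is a term in the language of $A$ expanded by all elements of $A$ as constants. An $n$-ary polynomial $p$ on $A$ is absorbing at $(e_1,\dots,e_n)\in A^n$ into $e\in A$ if $p(a_1,\dots,a_n)=e$ whenever $a_1,\dots,a_n\in A$ satisfy $a_i=e_i$ for at least one $i$. The algebra $A$ is $k$-supernilpotent if all polynomials on $A$ in at least $k+1$ variables that are absorbing (at any tuple and into any element) are constant (as functions). *)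

(* Defs.v *)
From mathcomp Require Import all_boot.
From mathcomp Require Import boolp classical_sets.

Set Implicit Arguments.
Unset Strict Implicit.
Unset Printing Implicit Defensive.

Local Open Scope classical_set_scope.

Record loop := Loop {
  carrier :> Type;
  lmul : carrier -> carrier -> carrier;
  ldiv : carrier -> carrier -> carrier; (* [ldiv a b] is a\b *)
  rdiv : carrier -> carrier -> carrier; (* [rdiv b a] is b/a *)
  lone : carrier;
  lmul1l : forall a, lmul lone a = a;
  lmul1r : forall a, lmul a lone = a;
  ldivP : forall a b x, lmul a x = b <-> x = ldiv a b;
  rdivP : forall a b x, lmul x a = b <-> x = rdiv b a }.

Arguments lone {l}.

Declare Scope loop_scope.
Delimit Scope loop_scope with loop.
Notation "x * y" := (lmul x y) : loop_scope.
Notation "x \ y" := (ldiv x y)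
  (at level 40, left associativity) : loop_scope.
Notation "x / y" := (rdiv x y) : loop_scope.
Notation "1" := lone : loop_scope.
Local Open Scope loop_scope.

Record loop_hom (Q L : loop) := LoopHom {
  hom_fun :> Q -> L;
  homM : forall x y, hom_fun (x * y) = hom_fun x * hom_fun y;
  hom_ldiv : forall x y, hom_fun (x \ y) = hom_fun x \ hom_fun y;
  hom_rdiv : forall x y, hom_fun (x / y) = hom_fun x / hom_fun y;
  hom1 : hom_fun 1 = 1 }.

Definition loop_ker (Q L : loop) (f : loop_hom Q L) : set Q :=
  [set x | f x = 1].

(* A kernel is automatically a subloop. *)
Definition normal (Q : loop) (N : set Q) : Prop :=
  exists (L : loop) (f : loop_hom Q L), N = loop_ker f.

Definition nucleus (Q : loop) : set Q :=
  [set a | forall u v : Q,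
    [/\ a * (u * v) = (a * u) * v,
        u * (a * v) = (u * a) * v &
        u * (v * a) = (u * v) * a]].
Arguments nucleus : clear implicits.

Definition lcoset (Q : loop) (N : set Q) (a : Q) : set Q :=
  [set a * n | n in N].

Record coset_of (Q : loop) (N : set Q) := Coset {
  coset_set :> set Q;
  coset_setP : exists a, coset_set = lcoset N a }.

Lemma coset_inj (Q : loop) (N : set Q) (A B : coset_of N) :
  A = B :> set Q -> A = B.
Proof.
case: A B => [A hA] [B hB] /= eAB; case: _ / eAB hB => hB.
by rewrite (Prop_irrelevance hA hB).
Qed.

Section Quotient.
Variables (Q : loop) (N : set Q).
Hypothesis nN : normal N.
Implicit Types (a b : Q) (A B X : coset_of N).

Lemma lcosetE (L : loop) (f : loop_hom Q L) a :
  N = loop_ker f -> lcoset N a = [set x | f x = f a].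
Proof.
move=> ->; apply/seteqP; split => [_ [n /= fn <-]|x /= fx].
  by rewrite /= homM fn lmul1r.
exists (a \ x); last by apply/ldivP.
by rewrite /loop_ker /= hom_ldiv fx; apply/esym/ldivP; rewrite lmul1r.
Qed.

Lemma lcosetM a b :
  [set x * y | x in lcoset N a & y in lcoset N b] = lcoset N (a * b).
Proof.
have [L [f eN]] := nN; rewrite !(lcosetE _ eN).
apply/seteqP; split => [_ [x /= fx [y /= fy <-]]|z /= fz].
  by rewrite !homM fx fy.
exists a => //; exists (a \ z); last by apply/ldivP.
by rewrite /= hom_ldiv fz homM; apply/esym/ldivP.
Qed.

Lemma lcoset_ldiv a b :
  [set x \ y | x in lcoset N a & y in lcoset N b] = lcoset N (a \ b).
Proof.
have [L [f eN]] := nN; rewrite !(lcosetE _ eN).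
apply/seteqP; split => [_ [x /= fx [y /= fy <-]]|z /= fz].
  by rewrite !hom_ldiv fx fy.
exists a => //; exists (a * z); last by apply/esym/ldivP.
by rewrite /= homM fz hom_ldiv; apply/ldivP.
Qed.

Lemma lcoset_rdiv a b :
  [set x / y | x in lcoset N a & y in lcoset N b] = lcoset N (a / b).
Proof.
have [L [f eN]] := nN; rewrite !(lcosetE _ eN).
apply/seteqP; split => [_ [x /= fx [y /= fy <-]]|z /= fz].
  by rewrite !hom_rdiv fx fy.
exists (z * b); first by rewrite /= homM fz hom_rdiv; apply/rdivP.
by exists b => //; apply/esym/rdivP.
Qed.

Definition coset (a : Q) : coset_of N := Coset (ex_intro _ a erefl).

Lemma coset_surj A : exists a, A = coset a.
Proof. by case: (coset_setP A) => a eA; exists a; apply: coset_inj. Qed.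

Fact coset_mulP A B :
  exists a, [set x * y | x in A & y in B] = lcoset N a.
Proof.
have [a ->] := coset_surj A; have [b ->] := coset_surj B.
by exists (a * b); apply: lcosetM.
Qed.

Fact coset_ldivP A B :
  exists a, [set x \ y | x in A & y in B] = lcoset N a.
Proof.
have [a ->] := coset_surj A; have [b ->] := coset_surj B.
by exists (a \ b); apply: lcoset_ldiv.
Qed.

Fact coset_rdivP A B :
  exists a, [set x / y | x in A & y in B] = lcoset N a.
Proof.
have [a ->] := coset_surj A; have [b ->] := coset_surj B.
by exists (a / b); apply: lcoset_rdiv.
Qed.

Definition coset_mul A B : coset_of N := Coset (coset_mulP A B).
Definition coset_ldiv A B : coset_of N := Coset (coset_ldivP A B).
Definition coset_rdiv A B : coset_of N := Coset (coset_rdivP A B).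

Lemma coset_mulE a b : coset_mul (coset a) (coset b) = coset (a * b).
Proof. by apply: coset_inj; apply: lcosetM. Qed.

Lemma coset_ldivE a b : coset_ldiv (coset a) (coset b) = coset (a \ b).
Proof. by apply: coset_inj; apply: lcoset_ldiv. Qed.

Lemma coset_rdivE a b : coset_rdiv (coset a) (coset b) = coset (a / b).
Proof. by apply: coset_inj; apply: lcoset_rdiv. Qed.

Fact coset_mul1l A : coset_mul (coset 1) A = A.
Proof. by have [a ->] := coset_surj A; rewrite coset_mulE lmul1l. Qed.

Fact coset_mul1r A : coset_mul A (coset 1) = A.
Proof. by have [a ->] := coset_surj A; rewrite coset_mulE lmul1r. Qed.

Fact coset_ldiv_axiom A B X : coset_mul A X = B <-> X = coset_ldiv A B.
Proof.
have [a ->] := coset_surj A; have [b ->] := coset_surj B.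
have [x ->] := coset_surj X; split => [<-|->].
  rewrite coset_mulE coset_ldivE; congr coset; exact/ldivP.
by rewrite coset_ldivE coset_mulE; congr coset; apply/ldivP.
Qed.

Fact coset_rdiv_axiom A B X : coset_mul X A = B <-> X = coset_rdiv B A.
Proof.
have [a ->] := coset_surj A; have [b ->] := coset_surj B.
have [x ->] := coset_surj X; split => [<-|->].
  rewrite coset_mulE coset_rdivE; congr coset; exact/rdivP.
by rewrite coset_rdivE coset_mulE; congr coset; apply/rdivP.
Qed.

Definition quotient_loop : loop :=
  Loop coset_mul1l coset_mul1r coset_ldiv_axiom coset_rdiv_axiom.

End Quotient.

Inductive loop_poly (Q : loop) (n : nat) : Type :=
  | PVar of 'I_n
  | PConst of Q
  | POne
  | PMul of loop_poly Q n & loop_poly Q n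
  | PLdiv of loop_poly Q n & loop_poly Q n
  | PRdiv of loop_poly Q n & loop_poly Q n.

Fixpoint peval (Q : loop) (n : nat) (p : loop_poly Q n) (a : 'I_n -> Q) : Q :=
  match p with
  | PVar i => a i
  | PConst c => c
  | POne => 1
  | PMul p1 p2 => peval p1 a * peval p2 a
  | PLdiv p1 p2 => peval p1 a \ peval p2 a
  | PRdiv p1 p2 => peval p1 a / peval p2 a
  end.

Definition absorbing (Q : loop) (n : nat) (p : loop_poly Q n)
    (es : 'I_n -> Q) (e : Q) : Prop :=
  forall a : 'I_n -> Q, (exists i, a i = es i) -> peval p a = e.

Definition constant_poly (Q : loop) (n : nat) (p : loop_poly Q n) : Prop :=
  forall a b : 'I_n -> Q, peval p a = peval p b.

Definition supernilpotent (k : nat) (Q : loop) : Prop :=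
  forall (n : nat) (p : loop_poly Q n) (es : 'I_n -> Q) (e : Q),
    (k.+1 <= n)%N -> absorbing p es e -> constant_poly p.

(* Main.v *)
Require Import Defs.
From mathcomp Require Import all_boot.
From mathcomp Require Import boolp classical_sets.

(** Lift a polynomial of arity [n >= k - 1] absorbing on [Q / Nuc Q] to [Q] and
    correct it by elements of the nucleus until it is absorbing into [1] on [Q].
    The associators of such a polynomial [p] with two fresh variables [u], [v]
    are absorbing of arity [n + 2 >= k + 1], hence trivial; so [p] takes all its
    values in the nucleus. *)

Set Implicit Arguments.
Unset Strict Implicit.
Unset Printing Implicit Defensive.

Local Open Scope loop_scope.

Lemma rdivxx (Q : loop) (x : Q) : x / x = 1.
Proof. by apply/esym/rdivP; rewrite lmul1l. Qed.

Lemma rdivx1 (Q : loop) (x : Q) : x / 1 = x.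
Proof. by apply/esym/rdivP; rewrite lmul1r. Qed.

Lemma rdiv_eq1 (Q : loop) (x y : Q) : x / y = 1 -> x = y.
Proof. by move=> xy1; rewrite -[RHS]lmul1l; apply/esym/rdivP. Qed.

Fixpoint psubst (Q : loop) (n m : nat) (s : 'I_n -> loop_poly Q m)
    (p : loop_poly Q n) : loop_poly Q m :=
  match p with
  | PVar i => s i
  | PConst c => PConst m c
  | POne => POne Q m
  | PMul p1 p2 => PMul (psubst s p1) (psubst s p2)
  | PLdiv p1 p2 => PLdiv (psubst s p1) (psubst s p2)
  | PRdiv p1 p2 => PRdiv (psubst s p1) (psubst s p2)
  end.

Lemma peval_subst (Q : loop) (n m : nat) (s : 'I_n -> loop_poly Q m)
    (p : loop_poly Q n) (a : 'I_m -> Q) :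
  peval (psubst s p) a = peval p (fun i => peval (s i) a).
Proof. by elim: p => //= p1 -> p2 ->. Qed.

(** The quotient [PRdiv p q] is absorbing at [es] into [1], hence constant. This reduces an identity
    in more than [k] variables to the points with some coordinate in [es]. *)
Lemma supernilpotent_eq (k n : nat) (Q : loop) (p q : loop_poly Q n)
    (es : 'I_n -> Q) :
    supernilpotent k Q -> (k < n)%N ->
    (forall a, (exists i, a i = es i) -> peval p a = peval q a) ->
  forall a, peval p a = peval q a.
Proof.
move=> snQ kn pq a; apply: rdiv_eq1.
have abs : absorbing (PRdiv p q) es 1 by move=> b /pq /= ->; apply: rdivxx.
rewrite -[LHS]/(peval (PRdiv p q) a) (snQ _ _ _ _ kn abs a es).
(* As [0 <= k < n], there is an index 0, and [es] agrees with itself there. *)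
by apply: abs; exists (Ordinal (leq_ltn_trans (leq0n k) kn)).
Qed.

Lemma absorbing_nucleus (k n : nat) (Q : loop) (p : loop_poly Q n)
    (es : 'I_n -> Q) :
    supernilpotent k Q -> (k < n + 2)%N -> absorbing p es 1 ->
  forall a, nucleus Q (peval p a).
Proof.
move=> snQ kn abs a u v.
(* The first [n] variables feed [p]; the last two are [u] and [v], with absorbing value [1]. *)
pose P := psubst (fun i => PVar Q (lshift 2 i)) p.
pose U := PVar Q (rshift n (ord0 : 'I_2)).
pose V := PVar Q (rshift n (ord_max : 'I_2)).
pose es' (i : 'I_(n + 2)) := if split i is inl j then es j else 1.
pose x (i : 'I_(n + 2)) :=
  match split i with inl j => a j | inr j => if j == ord0 then u else v end.
have PE y : peval P y = peval p (fun i => y (lshift 2 i)) by apply: peval_subst.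
have Px : peval P x = peval p a.
  rewrite PE; congr peval; apply/funext => i.
  by rewrite /x (unsplitK (inl i)).
have Ux : peval U x = u by rewrite /= /x (unsplitK (inr ord0)).
have Vx : peval V x = v by rewrite /= /x (unsplitK (inr ord_max)).
(* An absorbed coordinate turns one of the three factors into [1], and the associativity laws below
   then follow from the unit laws. *)
have triv y : (exists i, y i = es' i) ->
    [\/ peval P y = 1, peval U y = 1 | peval V y = 1].
  case=> i; rewrite /es'; case: splitP => j ij yi.
    apply: Or31; rewrite PE; apply: abs; exists j; rewrite -yi.
    by congr y; apply: val_inj.
  have ei : i = rshift n j by apply: val_inj.
  rewrite {i ij}ei in yi.
  case: (eqVneq j ord0) yi => [-> yi|j0 yi]; first exact: Or32.
  apply: Or33; rewrite -yi /=; congr y; apply: val_inj => /=.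
  by case: j j0 {yi} => [[|[|]]].
split; rewrite -Px -Ux -Vx.
- apply: (@supernilpotent_eq k _ _ (PMul P (PMul U V)) (PMul (PMul P U) V) es') => // y.
  by case/triv => /= ->; rewrite ?lmul1l ?lmul1r.
- apply: (@supernilpotent_eq k _ _ (PMul U (PMul P V)) (PMul (PMul U P) V) es') => // y.
  by case/triv => /= ->; rewrite ?lmul1l ?lmul1r.
- apply: (@supernilpotent_eq k _ _ (PMul U (PMul V P)) (PMul (PMul U V) P) es') => // y.
  by case/triv => /= ->; rewrite ?lmul1l ?lmul1r.
Qed.

(** Absorption modulo the kernel of [f] is repaired one variable at a time: dividing by the
    specialization of variable [i] to [es i] gives [1] there, and [f] does not see the divisor,
    whose image is [1]. *)
Lemma absorbing_lift (Q L : loop) (f : loop_hom Q L) (n : nat)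
    (p : loop_poly Q n) (es : 'I_n -> Q) :
    (forall a, (exists i, a i = es i) -> f (peval p a) = 1) ->
  exists2 q, absorbing q es 1 & forall a, f (peval q a) = f (peval p a).
Proof.
move=> fp1.
suff [q q1 fqp] : exists2 q : loop_poly Q n,
    forall i a, i \in enum 'I_n -> a i = es i -> peval q a = 1
    & forall a, f (peval q a) = f (peval p a).
  by exists q => // a [i ai]; apply: (q1 i); rewrite ?mem_enum.
(* The list holds the variables already repaired; [p] itself serves for the empty list. *)
elim: (enum 'I_n) => [|i s [q q1 fqp]]; first by exists p.
pose r a j := if j == i then es i else a j.
pose q' := psubst (fun j => if j == i then PConst n (es i) else PVar Q j) q.
have q'E a : peval q' a = peval q (r a).
  by rewrite peval_subst; congr peval; apply/funext => j; rewrite /r; case: ifP.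
exists (PRdiv q q') => [j a|a] /=; rewrite q'E.
  rewrite inE => /orP[/eqP-> ai|js aj].
    suff -> : r a = a by apply: rdivxx.
    by apply/funext => l; rewrite /r; case: eqP => // ->.
  (* Specializing variable [i] keeps the coordinate [j] at [es j], so numerator and denominator are
     both [1]. *)
  have rj : r a j = es j by rewrite /r; case: eqP => // ->.
  by rewrite (q1 j) // (q1 j (r a)) // rdivxx.
rewrite hom_rdiv !fqp (fp1 (r a)) ?rdivx1 //.
by exists i; rewrite /r eqxx.
Qed.

Lemma poly_quotient_lift (Q : loop) (N : set Q) (nN : normal N) (n : nat)
    (p : loop_poly (quotient_loop nN) n) :
  exists q : loop_poly Q n, forall a : 'I_n -> Q,
    peval p (fun i => coset N (a i)) = coset N (peval q a).
Proof.
elim: p => [i|c||p1 [q1 e1] p2 [q2 e2]|p1 [q1 e1] p2 [q2 e2]|p1 [q1 e1] p2 [q2 e2]].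
- by exists (PVar Q i).
- by have [c' ->] := coset_surj c; exists (PConst n c').
- by exists (POne Q n).
- by exists (PMul q1 q2) => a /=; rewrite e1 e2; apply: coset_mulE.
- by exists (PLdiv q1 q2) => a /=; rewrite e1 e2; apply: coset_ldivE.
- by exists (PRdiv q1 q2) => a /=; rewrite e1 e2; apply: coset_rdivE.
Qed.

Lemma coset_eqP (Q L : loop) (f : loop_hom Q L) (N : set Q) (a b : Q) :
  N = loop_ker f -> coset N a = coset N b <-> f a = f b.
Proof.
move=> eN; split => [/(congr1 (@coset_set _ _)) /=|fab].
  by rewrite !(lcosetE _ eN) => /seteqP[/(_ a erefl)].
by apply: coset_inj; rewrite /= !(lcosetE _ eN) fab.
Qed.

Theorem lemma6p8 (k : nat) (Q : loop) (nN : normal (nucleus Q)) :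
  (3 <= k)%N -> supernilpotent k Q ->
  supernilpotent (k - 2)%N (quotient_loop nN).
Proof.
move=> k3 snQ n p es e kn abs.
(* The truncated subtraction is exact since [2 <= k]. *)
have kn2 : (k < n + 2)%N.
  by move: kn; rewrite -(leq_add2r 2) addSn subnK // ltnW.
have [L [f eN]] := nN.
have [q pq] := poly_quotient_lift p.
have lift (a : 'I_n -> quotient_loop nN) :
    exists b : 'I_n -> Q, a = fun i => coset (nucleus Q) (b i).
  have [b ab] := choice (fun i => coset_surj (a i)).
  by exists b; apply/funext.
have [d ed] := coset_surj e; have [ds eds] := lift es.
(* Dividing by a representative of [e] moves the absorbed value to [1] modulo the nucleus. *)
pose q0 := PRdiv q (PConst n d).
have q01 a : (exists i, a i = ds i) -> f (peval q0 a) = 1.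
  move=> [i ai]; rewrite /= hom_rdiv.
  suff -> : f (peval q a) = f d by apply: rdivxx.
  apply/(coset_eqP _ _ eN); rewrite -pq -ed.
  by apply: abs; exists i; rewrite eds ai.
have [r absr fr] := absorbing_lift q01.
suff pe a : peval p a = e by move=> a b; rewrite !pe.
have [b ->] := lift a; rewrite pq ed; apply/(coset_eqP _ _ eN).
(* The corrected polynomial [r] has the same image under [f] as [q0], and its values lie in the
   nucleus, which is the kernel of [f]. *)
apply: rdiv_eq1; rewrite -hom_rdiv -[_ / _]/(peval q0 b) -fr.
by have := absorbing_nucleus snQ kn2 absr b; rewrite eN.
Qed.
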